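(* Let $A$ be a complete discrete valuation ring in which $2$ is a unit, with maximal ideal $\mathfrak r$, an involution $*$, and a fixed uniformiser $y$, where $y^*=-y$ if $*$ is nontrivial. Let $B$ be the fixed field of the involution induced by $*$ on $A/\mathfrak r$, and suppose that the norm map $\mathcal N:A/\mathfrak r\to B$, $a+\mathfrak r\mapsto aa^*+\mathfrak r$, is surjective. Let $m>0$. (1) Suppose $*$ is nontrivial, and let $M\in M_m(A)$ be skew hermitian (resp. hermitian). Then $M$ is $*$-congruent to one and only one matrix of the form $\bigoplus_{i=0}^\infty y^iM_i$, where every $M_i$ of size $>0$ is equal to a direct sum of copies of $\begin{pmatrix}0&1\\-1&0\end{pmatrix}$ if $i$ is even (resp. odd) and is equal to the identity matrix if $i$ is odd (resp. even). (2) Suppose $*$ is trivial, and let $M\in M_m(A)$ be skew symmetric (resp. symmetric). Then $M$ is $*$-congruent to one and only one matrix of the form $\bigoplus_{i=0}^\infty y^iM_i$, where every $M_i$ of size $>0$ is equal to a direct sum of copies of $\begin{pmatrix}0&1\\-1&0\end{pmatrix}$ (resp. equal to the identity matrix).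
   Context: An involution of $A$ is a ring automorphism $a\mapsto a^*$ of order at most two (the identity is allowed, and is called trivial). A uniformiser is a generator of $\mathfrak r$; if $*$ is nontrivial, a uniformiser with $y^*=-y$ always exists. Complete means that $\bigcap_{i\ge1}\mathfrak r^i=0$ and $A$ is complete for its $\mathfrak r$-adic metric. A matrix $C\in M_m(A)$ is hermitian (resp. skew hermitian) if $C'^*=C$ (resp. $C'^*=-C$), where $C'$ is the transpose and $*$ is applied entrywise; when $*$ is trivial these are the symmetric (resp. skew symmetric) matrices. Matrices $C,D\in M_m(A)$ are $*$-congruent if $D=X'^*CX$ for some $X\in GL_m(A)$. Convention: $y^\infty=0$, and a direct sum $\bigoplus_{i=0}^\infty y^iM_i$ denotes a block diagonal $m\times m$ matrix $M_0\oplus yM_1\oplus y^2M_2\oplus\cdots\oplus y^\infty M_\infty$ in which all but finitely many blocks have size $0$; the last summand $y^\infty M_\infty$ is a zero block (possibly of size $0$), and the conditions on $M_i$ concern $0\le i<\infty$.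
   Formalization: Part (1) additionally assumes that * induces the trivial involution on A/r; without it the claim fails, e.g. A = Z_3[i] with conjugation, y = 3i, m = 1, M = (i), which is skew hermitian but congruent to no listed form. *)

(* Defs.v *)
From HB Require Import structures.
From mathcomp Require Import all_boot all_order all_algebra.
From mathcomp Require Import ring_quotient generic_quotient.

Set Implicit Arguments.
Unset Strict Implicit.
Unset Printing Implicit Defensive.

Import GRing.Theory.
Local Open Scope ring_scope.
Local Open Scope quotient_scope.

(* [ideal_quot] needs boolean ideals; arbitrary ideals, over which the
   principal ideal property quantifies, are Prop-valued. *)
Definition is_ideal (A : comNzRingType) (I : A -> Prop) : Prop :=
  I 0 /\ forall a x y, I x -> I y -> I (a * x + y).

Definition generates (A : comNzRingType) (I : A -> Prop) (g : A) : Prop :=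
  forall x, I x <-> exists a, x = a * g.

(* A discrete valuation ring: a local principal ideal domain which is not a
   field. *)
HB.mixin Record isDVR A of GRing.IntegralDomain A := {
  dvr_local : forall x y : A,
    x \isn't a GRing.unit -> y \isn't a GRing.unit ->
    x + y \isn't a GRing.unit;
  dvr_principal : forall I : A -> Prop, is_ideal I -> exists g, generates I g;
  dvr_not_field : exists x : A, (x != 0) && (x \isn't a GRing.unit)
}.

#[short(type="dvrType")]
HB.structure Definition DVR := { A of isDVR A & GRing.IntegralDomain A }.

Definition maxideal (A : dvrType) : {pred A} :=
  [pred x | x \isn't a GRing.unit].

Fact maxideal_closed (A : dvrType) : idealr_closed (@maxideal A).
Proof.
split; rewrite ?inE ?unitr0 ?unitr1 // => a u v.
rewrite !inE => Hu Hv; apply: dvr_local => //.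
by rewrite unitrM negb_and Hu orbT.
Qed.

HB.instance Definition _ (A : dvrType) :=
  isIdealr.Build A (@maxideal A) (@maxideal_closed A).

Notation residue A := {ideal_quot (@maxideal A)}.

Section ResidueField.
Variable A : dvrType.

Definition residue_inv (x : residue A) : residue A :=
  if x == 0 then 0 else \pi_(residue A) (repr x)^-1.

Lemma residue_pi_eq (a b : A) :
  (\pi_(residue A) a == \pi_(residue A) b) = (a - b \in @maxideal A).
Proof. by rewrite -Quotient.idealrBE. Qed.

Lemma residue_pi_eq0 (a : A) :
  (\pi_(residue A) a == 0) = (a \in @maxideal A).
Proof.
have -> : (0 : residue A) = \pi_(residue A) 0 by rewrite piE.
by rewrite residue_pi_eq subr0.
Qed.

Fact residue_mulVx (x : residue A) : x != 0 -> residue_inv x * x = 1.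
Proof.
rewrite /residue_inv => x0; rewrite (negbTE x0).
have Hu : repr x \is a GRing.unit.
  by move: x0; rewrite -{1}[x]reprK residue_pi_eq0 inE negbK.
by rewrite -[X in _ * X]reprK -[LHS]pi_mulr mulVr // pi_oner.
Qed.

Fact residue_inv0 : residue_inv 0 = 0.
Proof. by rewrite /residue_inv eqxx. Qed.

End ResidueField.

HB.instance Definition _ (A : dvrType) :=
  GRing.ComNzRing_isField.Build (residue A)
    (@residue_mulVx A) (@residue_inv0 A).

Section Completeness.
Variable A : dvrType.

(* The power [r ^ n] of the maximal ideal: sums of products of [n] elements
   of [r], with an extra coefficient in [A] so that [r ^ 0 = A]. *)
Definition maxideal_pow (n : nat) (x : A) : Prop :=
  exists2 s : seq (A * n.-tuple A),
    (forall p, p \in s -> all [in @maxideal A] p.2)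
  & x = \sum_(p <- s) p.1 * \prod_(a <- p.2) a.

(* Two elements are within [c ^ k], for the [r]-adic metric with ratio [c],
   exactly when they are congruent modulo [r ^ k]. *)
Definition adic_cauchy (u : nat -> A) : Prop :=
  forall k, exists N, forall i j, (N <= i)%N -> (N <= j)%N ->
    maxideal_pow k (u i - u j).

Definition adic_cvg (u : nat -> A) (l : A) : Prop :=
  forall k, exists N, forall i, (N <= i)%N -> maxideal_pow k (u i - l).

Definition complete_dvr : Prop :=
  (forall x : A, (forall n, (0 < n)%N -> maxideal_pow n x) -> x = 0) /\
  (forall u, adic_cauchy u -> exists l, adic_cvg u l).

Definition uniformiser (y : A) : Prop :=
  generates (fun x => x \in @maxideal A) y.

End Completeness.

Section Involution.
Variables (A : dvrType) (star : {rmorphism A -> A}).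

Definition trivial_involution : Prop := star =1 id.

Definition residue_star (x : residue A) : residue A :=
  \pi_(residue A) (star (repr x)).

Lemma residue_starE (a : A) : involutive star ->
  residue_star (\pi_(residue A) a) = \pi_(residue A) (star a).
Proof.
move=> starK; apply/eqP; rewrite /residue_star residue_pi_eq inE -rmorphB /=.
have: repr (\pi_(residue A) a) - a \in @maxideal A.
  by rewrite -residue_pi_eq reprK.
rewrite inE; apply: contra => /(rmorph_unit star) /=.
by rewrite starK.
Qed.

Definition residue_fixed : {pred residue A} :=
  [pred b | residue_star b == b].

Definition norm_surjective : Prop :=
  forall b, b \in residue_fixed -> exists x, x * residue_star x = b.

Variable m : nat.

Definition hermitian_mx (C : 'M[A]_m) : Prop := map_mx star C^T = C.

Definition skew_hermitian_mx (C : 'M[A]_m) : Prop := map_mx star C^T = - C.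

Definition star_congruent (C D : 'M[A]_m) : Prop :=
  exists2 X : 'M[A]_m, X \in unitmx & D = map_mx star X^T *m C *m X.

End Involution.

Section NormalForm.
Variable A : dvrType.

Definition Jmx : 'M[A]_2 := block_mx (0 : 'M_1) 1%:M (- 1%:M) (0 : 'M_1).

Definition is_dirsum_J n (B : 'M[A]_n) : Prop :=
  exists c (e : (\sum_(j < c) 2)%N = n),
    B = castmx (e, e) (\mxdiag_(j < c) Jmx).

(* [D] is [M 0 (+) y M 1 (+) y^2 M 2 (+) ... (+) 0], with [M i] of size [s i],
   [s i = 0] for [i >= K], and a last zero block of size [q]; the blocks of
   positive size are sums of copies of [Jmx] when [alt i], and identity
   matrices otherwise. *)
Definition normal_form (y : A) (alt : pred nat) m (D : 'M[A]_m) : Prop :=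
  exists (K : nat) (s : nat -> nat) (q : nat) (M : forall i, 'M[A]_(s i))
         (e : (\sum_(i < K) s i + q)%N = m),
  [/\ forall i, (K <= i)%N -> s i = 0%N,
      forall i, (0 < s i)%N -> if alt i then is_dirsum_J (M i) else M i = 1%:M
    & D = castmx (e, e)
            (block_mx (\mxdiag_(i < K) (y ^+ i *: M i)) 0 0 (0 : 'M_q))].

End NormalForm.

(* Main.v *)
(** Both parts are one statement: the residue involution is trivial, star y is y or
    -y, and M is eps-hermitian for a sign eps, so after dividing M by the largest
    possible power y^i one gets an eps_i-hermitian matrix with a unit entry, where
    the sign eps_i depends on i only. If eps_i = 1, a vector of unit norm can be
    found because 2 is a unit, and its norm can be made 1 by norm surjectivity and
    square roots of elements of 1 + r, which exist by completeness; if eps_i = -1, a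
    unit entry off the diagonal gives a hyperbolic plane J, again by means of a
    square root. This brick splits off orthogonally, and one recurses on the
    complement, which is still divisible by y^i.
    For uniqueness, a normal form is W diag(y^e) with W invertible. If
    R diag(y^e') = diag(y^e) Q with Q invertible, then Q l k lies in r whenever
    e l < n <= e' k; a zero block of an invertible matrix over the residue field
    being small, the numbers of exponents < n agree for every n. *)
Require Import Defs.
From HB Require Import structures.
From mathcomp Require Import all_boot all_order all_algebra.
From mathcomp Require Import ring_quotient generic_quotient.
From mathcomp Require Import perm ring.
From Stdlib Require Import Classical.
Set Implicit Arguments.
Unset Strict Implicit.
Unset Printing Implicit Defensive.
Import GRing.Theory.
Local Open Scope ring_scope.

(** * Divisibility by powers of the uniformiser, and square roots of elements of 1 + r *)

Section Uniformiser.
Variables (A : dvrType) (y : A).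
Hypothesis y_unif : uniformiser y.

Lemma nonunitD (x z : A) : x \isn't a GRing.unit -> z \isn't a GRing.unit ->
  x + z \isn't a GRing.unit.
Proof. exact: dvr_local. Qed.

Lemma nonunitN (x : A) : x \isn't a GRing.unit -> - x \isn't a GRing.unit.
Proof. by rewrite unitrN. Qed.

Lemma nonunitMl (x z : A) : x \isn't a GRing.unit -> z * x \isn't a GRing.unit.
Proof. by rewrite unitrM negb_and => ->; rewrite orbT. Qed.

Lemma unit_congr (x z : A) : z \is a GRing.unit -> x - z \isn't a GRing.unit ->
  x \is a GRing.unit.
Proof.
move=> zu xz; apply: contraLR zu => xn.
by rewrite -(subKr x z); apply: nonunitD => //; apply: nonunitN.
Qed.

Lemma nonunitP (x : A) : x \isn't a GRing.unit <-> exists a, x = a * y.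
Proof. exact: (y_unif x). Qed.

Lemma uniformiser_nonunit : y \isn't a GRing.unit.
Proof. by apply/nonunitP; exists 1; rewrite mul1r. Qed.

Lemma uniformiser_neq0 : y != 0.
Proof.
have [x /andP[x0 xn]] := @dvr_not_field A.
have /nonunitP[a xE] := xn.
by apply: contraNneq x0 => y0; rewrite xE y0 mulr0.
Qed.

Lemma maxideal_powP n (x : A) : maxideal_pow n x <-> exists a, x = a * y ^+ n.
Proof.
split=> [[s Hs ->]|[a ->]]; last first.
  exists [:: (a, [tuple of nseq n y])]; last first.
    by rewrite big_seq1 /= big_nseq -Monoid.iteropE.
  move=> p; rewrite inE => /eqP-> /=.
  by rewrite all_nseq [y \in _]uniformiser_nonunit orbT.
have dvd_prod (t : seq A) : all [in @maxideal A] t ->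
    exists a, \prod_(z <- t) z = a * y ^+ size t.
  elim: t => [|z t IH] /=; first by exists 1; rewrite big_nil mulr1.
  case/andP=> /nonunitP[a ->] /IH[b E]; exists (a * b).
  by rewrite big_cons E exprS mulrACA.
elim: s Hs => [|p s IH] Hs; first by exists 0; rewrite big_nil mul0r.
have [q qs|b E] := IH; first by apply: Hs; rewrite inE qs orbT.
have [|c Ec] := dvd_prod p.2; first by apply: Hs; rewrite inE eqxx.
exists (p.1 * c + b); rewrite big_cons E Ec size_tuple; ring.
Qed.

Hypothesis A_complete : complete_dvr A.

Lemma adic_separated (x : A) : (forall n, exists a, x = a * y ^+ n) -> x = 0.
Proof. by move=> H; apply: A_complete.1 => n _; apply/maxideal_powP. Qed.

(* The step w |-> w - (w^2 - u)/2 keeps w in 1 + r and improves the error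
   w^2 - u by one power of y. *)
Lemma sqrt_1D (u : A) : (2%:R : A) \is a GRing.unit ->
  u - 1 \isn't a GRing.unit ->
  exists2 w, w - 1 \isn't a GRing.unit & w * w = u.
Proof.
move=> two_unit /nonunitP[a0 u1].
have [h h2] : exists h : A, 2%:R * h = 1 by exists 2%:R^-1; rewrite divrr.
pose f w := w - (w * w - u) * h; pose w_ n := iter n f 1.
(* The invariant also keeps [w_ n] in 1 + r, because the step divides by 2 where Newton's method
   would divide by [2 w]. *)
have step n : exists a b, w_ n - 1 = a * y /\ w_ n * w_ n - u = b * y ^+ n.+1.
  elim: n => [|n [a [b [Ha Hb]]]].
    exists 0, (- a0); split; first by rewrite subrr mul0r.
    by rewrite /= mulr1 -opprB u1 mulNr expr1.
  exists (a - b * y ^+ n * h), (- b * a + b ^+ 2 * h ^+ 2 * y ^+ n).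
  have E : w_ n.+1 = w_ n - b * y ^+ n.+1 * h by rewrite -Hb.
  split; first by rewrite E addrAC Ha exprS; ring.
  (* Since [2 h = 1], the new error is [1 - w_ n] times the old one plus a multiple of its square;
     both terms gain a factor [y]. *)
  have -> : w_ n.+1 * w_ n.+1 - u
      = (w_ n * w_ n - u) - w_ n * (b * y ^+ n.+1) * (2%:R * h)
        + b ^+ 2 * h ^+ 2 * y ^+ n.+1 ^+ 2 by rewrite E; ring.
  rewrite h2 Hb.
  have -> : w_ n = 1 + a * y by rewrite -Ha; ring.
  by rewrite !exprS; ring.
have cong_w k i : (k <= i)%N -> exists c, w_ i - w_ k = c * y ^+ k.+1.
  move=> /subnKC<-; elim: (i - k)%N => [|j [c IH]].
    by exists 0; rewrite addn0 subrr mul0r.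
  have [a [b [_ Hb]]] := step (k + j)%N.
  exists (c - b * y ^+ j * h).
  rewrite addnS (_ : w_ _.+1 = w_ (k + j)%N - b * y ^+ (k + j).+1 * h);
    last by rewrite -Hb.
  by rewrite addrAC IH -addSn exprD; ring.
have cauchy_w : adic_cauchy w_.
  move=> k; exists k => i j ki kj; apply/maxideal_powP.
  have [[c Hc] [d Hd]] := (cong_w _ _ ki, cong_w _ _ kj).
  exists ((c - d) * y).
  by rewrite -(subrKA (w_ k)) Hc -(opprB (w_ j)) Hd exprS; ring.
have [w cvg_w] := A_complete.2 _ cauchy_w.
(* An index beyond both [N] and [k] makes the distance to the limit and the error of the iterate
   divisible by [y ^+ k] at once. *)
have near_w k : exists i a, (k <= i)%N /\ w = w_ i + a * y ^+ k.
  have [N HN] := cvg_w k.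
  have /maxideal_powP[a Ha] := HN _ (leq_maxl N k).
  exists (maxn N k), (- a); rewrite leq_maxr; split=> //.
  by rewrite mulNr -Ha; ring.
exists w.
  have [i [a [_ ->]]] := near_w 1%N; have [b [_ [Hb _]]] := step i.
  apply/nonunitP; exists (b + a); rewrite addrAC Hb; ring.
apply/eqP; rewrite -subr_eq0; apply/eqP/adic_separated => k.
have [i [a [ki ->]]] := near_w k; have [_ [b [_ Hb]]] := step i.
exists (b * y ^+ (i.+1 - k) + 2%:R * w_ i * a + a ^+ 2 * y ^+ k).
have -> : (w_ i + a * y ^+ k) * (w_ i + a * y ^+ k) - u
  = (w_ i * w_ i - u) + (2%:R * w_ i * a + a ^+ 2 * y ^+ k) * y ^+ k by ring.
by rewrite Hb -{1}(subnK (leqW ki)) exprD; ring.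
Qed.

(** If no such power existed, dividing by [y] could go on forever, so every entry would lie in all
    powers of r and vanish by separatedness. *)
Lemma factor_min_power m n (M : 'M[A]_(m, n)) : M != 0 ->
  exists i N k l, M = y ^+ i *: N /\ N k l \is a GRing.unit.
Proof.
move=> M0; apply: NNPP => no_min; case/eqP: M0.
have pw i : exists N, M = y ^+ i *: N.
  elim: i => [|i [N E]]; first by exists M; rewrite scale1r.
  have dvd_N k : exists f, forall l, N k l = f l * y.
    apply: (fin_all_exists (P := fun l a => N k l = a * y)) => l.
    apply/nonunitP/negP => Nu.
    by apply: no_min; exists i, N, k, l.
  have [f Hf] := fin_all_exists dvd_N.
  exists (\matrix_(k, l) f k l); rewrite E exprSr -scalerA; congr (_ *: _).
  by apply/matrixP=> k l; rewrite !mxE Hf mulrC.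
apply/matrixP=> k l; rewrite [RHS]mxE; apply: adic_separated => i.
by have [N ->] := pw i; exists (N k l); rewrite mxE mulrC.
Qed.

End Uniformiser.

(** * Normal forms encoded by lists of exponents *)

Section Bricks.
Variables (A : dvrType) (y : A) (alt : pred nat).

Definition brick_size i := if alt i then 2 else 1%N.

(* The matrix of size [m] with blocks y^i J or y^i for [i] in [L], followed by
   zeros (a junk value when the bricks do not fit in [m]). *)
Fixpoint brick_mx (L : seq nat) (m : nat) : 'M[A]_m :=
  match L with
  | [::] => 0
  | i :: L' =>
    if alt i then
      match m with
      | m'.+2 => block_mx (y ^+ i *: Jmx A) 0 0 (brick_mx L' m') : 'M_(2 + m')
      | _ => 0
      end
    else
      match m with
      | m'.+1 => block_mx (y ^+ i)%:M 0 0 (brick_mx L' m') : 'M_(1 + m')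
      | _ => 0
      end
  end.

Definition total_size L := sumn [seq brick_size i | i <- L].

End Bricks.

(** * Congruence and the elementary operations on hermitian forms *)

Section Adjoint.
Variables (A : dvrType) (star : {rmorphism A -> A}).
Hypothesis starK : involutive star.

Local Notation adj C := (map_mx star C^T).
Local Notation congr_mx := (star_congruent star).

Lemma adjM m n p (C : 'M[A]_(m, n)) (D : 'M_(n, p)) :
  adj (C *m D) = adj D *m adj C.
Proof. by rewrite trmx_mul map_mxM. Qed.

Lemma adjK m n (C : 'M[A]_(m, n)) : adj (adj C) = C.
Proof. by apply/matrixP=> i j; rewrite !mxE starK. Qed.

Lemma adj_block m n p q (a : 'M[A]_(m, p)) (b : 'M_(m, q)) (c : 'M_(n, p))
    (d : 'M_(n, q)) :
  adj (block_mx a b c d) = block_mx (adj a) (adj c) (adj b) (adj d).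
Proof. by rewrite tr_block_mx map_block_mx. Qed.

Lemma adj0 m n : adj (0 : 'M[A]_(m, n)) = 0.
Proof. by rewrite trmx0 map_mx0. Qed.

Lemma adj_scalar n (a : A) : adj (a%:M : 'M_n) = (star a)%:M.
Proof. by rewrite tr_scalar_mx map_scalar_mx. Qed.

Lemma adjZ m n a (C : 'M[A]_(m, n)) : adj (a *: C) = star a *: adj C.
Proof. by rewrite linearZ map_mxZ. Qed.

Lemma adj_unit n (X : 'M[A]_n) : X \in unitmx -> adj X \in unitmx.
Proof.
by move=> Xu; rewrite unitmxE det_map_mx det_tr rmorph_unit -?unitmxE.
Qed.

Lemma congr_refl n (C : 'M_n) : congr_mx C C.
Proof.
by exists 1%:M; rewrite ?unitmx1 // adj_scalar rmorph1 mul1mx mulmx1.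
Qed.

Lemma congr_trans n (D C E : 'M_n) : congr_mx C D -> congr_mx D E ->
  congr_mx C E.
Proof.
move=> [X Xu ->] [Y Yu ->]; exists (X *m Y); first by rewrite unitmx_mul Xu.
by rewrite adjM !mulmxA.
Qed.

Lemma congr_scale n a (C D : 'M_n) : congr_mx C D -> congr_mx (a *: C) (a *: D).
Proof. by move=> [X Xu ->]; exists X; rewrite // -scalemxAr -scalemxAl. Qed.

Lemma congr_block m n (a a' : 'M_m) (d d' : 'M_n) :
  congr_mx a a' -> congr_mx d d' ->
  congr_mx (block_mx a 0 0 d) (block_mx a' 0 0 d').
Proof.
move=> [X Xu ->] [Y Yu ->]; exists (block_mx X 0 0 Y).
  by rewrite unitmxE det_ublock unitrM -!unitmxE Xu.
by rewrite adj_block !mulmx_block !adj0 !(mul0mx, mulmx0, addr0, add0r).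
Qed.

(** The base change of the corner is extended by the identity; the other blocks may change and are
    cleared later. *)
Lemma congr_ulsub m n (N : 'M_(m + n)) (B : 'M_m) :
  congr_mx (ulsubmx N) B -> exists2 N', congr_mx N N' & ulsubmx N' = B.
Proof.
move=> [X Xu ->].
exists (adj (block_mx X 0 0 1%:M) *m N *m block_mx X 0 0 1%:M).
  exists (block_mx X 0 0 1%:M) => //.
  by rewrite unitmxE det_ublock det1 mulr1 -unitmxE.
rewrite -{1}[N]submxK adj_block !mulmx_block block_mxKul.
by rewrite !adj0 !(mul0mx, mulmx0, addr0, add0r).
Qed.

Lemma congr_adj n (e : A) (N N' : 'M_n) :
  adj N = e *: N -> congr_mx N N' -> adj N' = e *: N'.
Proof.
move=> HN [X Xu ->].
by rewrite !adjM adjK HN -scalemxAl -scalemxAr mulmxA.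
Qed.

Lemma congr_reindex n (N : 'M_n) (s : {perm 'I_n}) :
  congr_mx N (\matrix_(i, j) N (s i) (s j)).
Proof.
exists (perm_mx s^-1); first exact: unitmx_perm.
have -> : adj (perm_mx s^-1) = perm_mx s.
  by rewrite tr_perm_mx invgK map_perm_mx.
by rewrite -col_permE -row_permE; apply/matrixP => i j; rewrite !mxE.
Qed.

(** The base change replaces the k-th basis vector by its sum with the l-th; it serves to bring an
    off-diagonal unit onto the diagonal. *)
Lemma congr_add n (N : 'M_n) k l : k != l ->
  exists2 N', congr_mx N N' & N' k k = N k k + N k l + N l k + N l l.
Proof.
move=> kl; pose X : 'M[A]_n := 1%:M + delta_mx l k.
have Xu : X \in unitmx.
  suff /mulmx1_unit[]: X *m (1%:M - delta_mx l k) = 1%:M by [].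
  rewrite mulmxDl !mulmxBr !mulmx1 !mul1mx mul_delta_mx_cond (negbTE kl) mulr0n.
  by rewrite subr0 subrK.
exists (adj X *m N *m X); first by exists X.
have -> : adj X = 1%:M + delta_mx k l.
  by rewrite linearD /= map_mxD adj_scalar rmorph1 trmx_delta map_delta_mx.
have dl (M : 'M[A]_n) i j : (delta_mx k l *m M) i j = (i == k)%:R * M l j.
  rewrite mxE (bigD1 l) //= mxE eqxx andbT big1 ?addr0 // => u /negbTE ul.
  by rewrite mxE ul andbF mul0r.
have dr (M : 'M[A]_n) i j : (M *m delta_mx l k) i j = M i l * (j == k)%:R.
  rewrite mxE (bigD1 l) //= mxE eqxx big1 ?addr0 // => u /negbTE ul.
  by rewrite mxE ul mulr0.
have D (C E : 'M[A]_n) i j : (C + E) i j = C i j + E i j by rewrite mxE.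
rewrite mulmxDr mulmx1 D dr mulmxDl mul1mx !D !dl eqxx !mulr1n.
ring.
Qed.

(** Block elimination against the invertible corner; [E] is its Schur complement. *)
Lemma split_unit_block m n (e : bool) (N : 'M_(m + n)) :
  adj N = (-1) ^+ e *: N -> ulsubmx N \in unitmx ->
  exists E, congr_mx N (block_mx (ulsubmx N) 0 0 E).
Proof.
move=> HN Bu; set B := ulsubmx N.
pose X : 'M[A]_(m + n) := block_mx 1%:M (- invmx B *m ursubmx N) 0 1%:M.
have Xu : X \in unitmx by rewrite unitmxE det_ublock !det1 mulr1 unitr1.
have c : congr_mx N (adj X *m N *m X) by exists X.
have HN' := congr_adj HN c.
move: c HN'; set N' := _ *m X => c HN'.
have [Eul Eur] : ulsubmx N' = B /\ ursubmx N' = 0.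
  rewrite /N' -mulmxA -{1 2}[N]submxK /X adj_block !mulmx_block.
  rewrite block_mxKul block_mxKur !adj0 adj_scalar rmorph1.
  rewrite !(mul0mx, mulmx0, mul1mx, mulmx1, addr0, add0r).
  rewrite mulmxA mulmxN mulmxV //.
  by rewrite mulNmx mul1mx addNr.
(* The symmetry of [N] passes to [N'], so the lower left block vanishes together with the upper
   right one. *)
have Edl : dlsubmx N' = 0.
  apply/matrixP => i j; have /matrixP/(_ (rshift m i) (lshift n j)) := HN'.
  have /matrixP/(_ j i) := Eur; rewrite !mxE => ->; rewrite rmorph0.
  by move/esym/eqP; rewrite mulf_eq0 signr_eq0 => /eqP.
by exists (drsubmx N'); rewrite -[X in congr_mx N (block_mx _ X _ _)]Eur
  -[X in congr_mx N (block_mx _ _ X _)]Edl -Eul submxK.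
Qed.

End Adjoint.

(** * Existence: splitting off one brick at a time *)

Section Reduction.
Local Open Scope quotient_scope.
Variables (A : dvrType) (star : {rmorphism A -> A}) (y : A).
Hypotheses (A_complete : complete_dvr A)
  (two_unit : (2%:R : A) \is a GRing.unit)
  (starK : involutive star) (y_unif : uniformiser y)
  (norm_surj : norm_surjective star)
  (res_triv : residue_star star =1 id).

Local Notation adj C := (map_mx star C^T).
Local Notation congr_mx := (star_congruent star).

Lemma star_nonunit (x : A) :
  x \isn't a GRing.unit -> star x \isn't a GRing.unit.
Proof. by apply: contra => /(rmorph_unit star); rewrite starK. Qed.

Lemma star_congr (x : A) : star x - x \isn't a GRing.unit.
Proof.
have /eqP := res_triv (\pi_(residue A) x).
by rewrite residue_starE // residue_pi_eq.
Qed.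

Lemma unit_double (x : A) :
  (x + x \is a GRing.unit) = (x \is a GRing.unit).
Proof. by rewrite -mulr2n -mulr_natl unitrM two_unit. Qed.

(** If [w] is a root in 1 + r, then [star w] is [w] or [- w]; the latter is excluded because
    [star w + w] is congruent to the unit 2. *)
Lemma sqrt_fixed (u : A) : star u = u -> u - 1 \isn't a GRing.unit ->
  exists w, [/\ star w = w, w - 1 \isn't a GRing.unit & w * w = u].
Proof.
move=> su u1; have [w w1 ww] := sqrt_1D y_unif A_complete two_unit u1.
exists w; split=> //; apply/eqP; rewrite -subr_eq0.
have sw : star w * star w = u by rewrite -rmorphM ww.
have : (star w - w) * (star w + w) == 0 by rewrite -subr_sqr !expr2 sw ww subrr.
rewrite mulf_eq0 => /orP[//|/eqP z].
have : (star w + w) - 2%:R \isn't a GRing.unit.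
  have -> : star w + w - 2%:R = star (w - 1) + (w - 1).
    by rewrite rmorphB rmorph1; ring.
  by apply: nonunitD => //; apply: star_nonunit.
by rewrite z sub0r unitrN two_unit.
Qed.

(** Norm surjectivity gives [x] whose norm is congruent to [d]. The quotient of [d] by this norm is
    fixed and lies in 1 + r, and its fixed square root corrects [x]. *)
Lemma norm_unit (d : A) : d \is a GRing.unit -> star d = d ->
  exists2 x, x \is a GRing.unit & star x * x = d.
Proof.
move=> du sd.
have [|x0] := norm_surj (b := \pi_(residue A) d).
  by rewrite inE residue_starE // sd.
rewrite -[x0]reprK residue_starE // -rmorphM /= => /eqP.
rewrite residue_pi_eq; set x := repr x0 => near.
have nu : x * star x \is a GRing.unit by apply: unit_congr near.
have [xu sxu] : x \is a GRing.unit /\ star x \is a GRing.unit.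
  by move: nu; rewrite unitrM => /andP.
have [||w [sw w1 ww]] := sqrt_fixed (u := d / (x * star x)).
- by rewrite rmorphM rmorphV // rmorphM starK sd [star x * x]mulrC.
- rewrite -(divrr nu) -mulrBl; apply: contraNN near => H.
  rewrite -opprB unitrN; move: H; rewrite unitrM => /andP[] //.
exists (x * w).
  by rewrite unitrM xu (@unit_congr _ w 1) ?unitr1.
rewrite rmorphM sw [LHS](_ : _ = x * star x * (w * w)); last by ring.
by rewrite ww mulrC divrK.
Qed.

Lemma herm_unit_corner n (N : 'M_(1 + n)) k l : adj N = N ->
  N k l \is a GRing.unit ->
  exists2 N', congr_mx N N' & ulsubmx N' = 1%:M.
Proof.
move=> HN kl.
have [N1 [c1 d1]] : exists N1, congr_mx N N1 /\
    exists k1, N1 k1 k1 \is a GRing.unit.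
  have [kk|kk] := boolP (N k k \is a GRing.unit).
    by exists N; split; [exact: congr_refl|exists k].
  have [ll|ll] := boolP (N l l \is a GRing.unit).
    by exists N; split; [exact: congr_refl|exists l].
  have nkl : k != l by apply: contraNneq kk => E; rewrite {2}E.
  (* With both diagonal entries in r, the new diagonal entry is congruent to [N k l + star (N k l)],
     hence to twice the unit [N k l]. *)
  have [N1 c1 E] := congr_add star N nkl.
  exists N1; split=> //; exists k; rewrite E.
  have lk : N l k = star (N k l) by rewrite -[N in LHS]HN !mxE.
  apply: (@unit_congr _ _ (N k l + N k l)); first by rewrite unit_double.
  rewrite lk (_ : _ - _ = N k k + N l l + (star (N k l) - N k l)); last by ring.
  by apply: nonunitD; [apply: nonunitD|apply: star_congr].
have [k1 u1] := d1.
have c2 := congr_reindex star N1 (tperm (lshift n 0) k1).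
move: c2; set N2 := \matrix_(i, j) _ => c2.
have [d Ed du] : exists2 d, ulsubmx N2 = d%:M & d \is a GRing.unit.
  exists (N1 k1 k1) => //; apply/matrixP=> i j; rewrite !ord1 !mxE.
  by rewrite tpermL eqxx mulr1n.
have c12 := congr_trans c1 c2.
have sd : star d = d.
  have H : adj N = 1 *: N by rewrite scale1r.
  have /matrixP/(_ (lshift n 0) (lshift n 0)) := congr_adj starK H c12.
  have /matrixP/(_ 0 0) := Ed; rewrite !mxE eqxx mulr1n mul1r => ->; exact.
(* Rescaling by an element of norm [d^-1] turns the corner [d] into 1. *)
have [||x xu xx] := @norm_unit d^-1; rewrite ?unitrV // ?rmorphV ?sd //.
have [|N3 c3 E3] := @congr_ulsub _ star _ _ N2 1%:M.
  exists x%:M; first by rewrite unitmxE det_scalar unitrX.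
  rewrite Ed adj_scalar -!scalar_mxM mulrAC xx mulVr //.
by exists N3 => //; apply: congr_trans c3.
Qed.

(** Built from 1 x 1 blocks like [Jmx], so that congruences of 2 x 2 matrices reduce to identities
    between entries. *)
Definition mx2 (a b c d : A) : 'M[A]_2 :=
  block_mx (a%:M : 'M_1) b%:M c%:M (d%:M : 'M_1).

Lemma mx2E (C : 'M[A]_2) : C = mx2 (C 0 0) (C 0 1) (C 1 0) (C 1 1).
Proof.
apply: etrans (esym (@submxK _ 1 1 1 1 C)) _; rewrite /mx2.
by congr block_mx; rewrite [LHS]mx11_scalar !mxE; congr (C _ _)%:M;
  apply: val_inj.
Qed.

Lemma mx2_inj a b c d a' b' c' d' : mx2 a b c d = mx2 a' b' c' d' ->
  [/\ a = a', b = b', c = c' & d = d'].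
Proof.
have inj (x x' : A) : (x%:M : 'M_1) = x'%:M -> x = x'.
  by move/matrixP/(_ 0 0); rewrite !mxE.
by rewrite /mx2 => /(@eq_block_mx _ 1 1 1 1)[/inj-> /inj-> /inj-> /inj->].
Qed.

Lemma adj_mx2 a b c d : adj (mx2 a b c d)
  = mx2 (star a) (star c) (star b) (star d).
Proof. by rewrite /mx2 (@adj_block _ star 1 1 1 1) !adj_scalar. Qed.

Lemma opp_mx2 a b c d : - mx2 a b c d = mx2 (- a) (- b) (- c) (- d).
Proof. by rewrite /mx2 !raddfN; apply: (@opp_block_mx _ 1 1 1 1). Qed.

Lemma mul_mx2 a b c d a' b' c' d' : mx2 a b c d *m mx2 a' b' c' d' =
  mx2 (a * a' + b * c') (a * b' + b * d') (c * a' + d * c') (c * b' + d * d').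
Proof. by rewrite /mx2 (@mulmx_block _ 1 1 1 1 1 1) -!scalar_mxM -!raddfD. Qed.

Lemma det_mx2 (C : 'M[A]_2) : \det C = C 0 0 * C 1 1 - C 0 1 * C 1 0.
Proof.
rewrite (expand_det_row _ 0) !big_ord_recl big_ord0 addr0 /cofactor.
rewrite !det_mx11 !mxE /= expr0 expr1 mul1r mulN1r mulrN.
by congr (C _ _ * C _ _ - C _ _ * C _ _); apply: val_inj.
Qed.

Lemma unit_mx2 a b c d :
  (mx2 a b c d \in unitmx) = (a * d - b * c \is a GRing.unit).
Proof.
by rewrite unitmxE det_mx2; have [<- <- <- <-] := mx2_inj (mx2E (mx2 a b c d)).
Qed.

Lemma Jmx2 : Jmx A = mx2 0 1 (-1) 0.
Proof. by rewrite /mx2 !raddf0 raddfN. Qed.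

Lemma congr_mx2 p q r s a b c d a' b' c' d' :
  p * s - q * r \is a GRing.unit ->
  mx2 a' b' c' d' =
    mx2 (star p) (star r) (star q) (star s) *m mx2 a b c d *m mx2 p q r s ->
  congr_mx (mx2 a b c d) (mx2 a' b' c' d').
Proof. by move=> u ->; exists (mx2 p q r s); rewrite ?unit_mx2 ?adj_mx2. Qed.

(** As [star a] is congruent to [a], the element [2 a] lies in r, and 2 is a unit. *)
Lemma skew_nonunit (a : A) : star a = - a -> a \isn't a GRing.unit.
Proof.
by move=> sa; have := star_congr a; rewrite sa -opprD unitrN unit_double.
Qed.

(** Four base changes: make the off-diagonal entries 1 and -1, replace the first basis vector by an
    isotropic one, restore 1 and -1, and clear the last diagonal entry. *)
Lemma skew_mx2 (C : 'M[A]_2) : adj C = - C -> C 0 1 \is a GRing.unit ->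
  congr_mx C (Jmx A).
Proof.
move=> HC; have : adj (mx2 (C 0 0) (C 0 1) (C 1 0) (C 1 1))
    = - mx2 (C 0 0) (C 0 1) (C 1 0) (C 1 1) by rewrite -mx2E.
rewrite [in congr_mx _ _](mx2E C) Jmx2 {HC}.
move: (C 0 0) (C 0 1) (C 1 0) (C 1 1) => a b c d.
rewrite adj_mx2 opp_mx2; case/mx2_inj => sa sc sb sd bu.
have {sc} cE : c = - star b by rewrite sb opprK.
have sbu : star b \is a GRing.unit by rewrite rmorph_unit.
set d1 := (star b)^-1 * d * b^-1.
have sd1 : star d1 = - d1.
  by rewrite /d1 !rmorphM !rmorphV // starK sd; ring.
have c1 : congr_mx (mx2 a b c d) (mx2 a 1 (-1) d1).
  apply: (@congr_mx2 1 0 0 b^-1); first by rewrite mul1r mul0r subr0 unitrV.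
  rewrite rmorph1 rmorph0 rmorphV // cE !mul_mx2 /d1; congr mx2.
  - ring.
  - by rewrite !(mul0r, mulr0, addr0, add0r, mul1r) divrr.
  - by rewrite !(mul0r, mulr0, addr0, add0r, mulr1) mulrN mulVr.
  - ring.
clearbody d1.
(* [1 + a * d1] is a quarter of the discriminant of the isotropy equation; it lies in 1 + r because
   skew elements lie in r. *)
have [||s [ss s1 s2]] := @sqrt_fixed (1 + a * d1).
- by rewrite rmorphD rmorph1 rmorphM sa sd1 mulrNN.
- by rewrite addrAC subrr add0r mulrC nonunitMl // skew_nonunit.
have su : 1 + s \is a GRing.unit.
  apply: (@unit_congr _ _ 2%:R) => //.
  by rewrite (_ : _ - _ = s - 1) //; ring.
(* [t] solves the isotropy equation a + 2 t - d1 t^2 = 0; this form of the root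
   needs no division by [d1]. *)
set t := - a / (1 + s).
have st : star t = - t.
  by rewrite /t rmorphM rmorphV // rmorphD rmorph1 ss rmorphN sa mulNr.
have quad : a + t + t - t * t * d1 = 0.
  have := divrr su; rewrite /t; move: (1 + s)^-1 => h hs.
  have -> : a + - a * h + - a * h - - a * h * (- a * h) * d1 =
    a * ((1 + s) * h - 1) * ((1 + s) * h - 1) * 0
    + a * (1 - 2%:R * h - h * h * (1 + a * d1 - 1)) by ring.
  rewrite -s2; have -> : 1 - 2%:R * h - h * h * (s * s - 1) =
    1 - h * (2%:R + (s - 1) * ((1 + s) * h)) by ring.
  rewrite hs mulr1 (_ : h * _ = (1 + s) * h); last by ring.
  by rewrite hs subrr !mulr0 addr0.
clearbody t.
set p := 1 - t * d1.
have sp : star p = p.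
  by rewrite rmorphB rmorph1 rmorphM st sd1 mulrNN.
have pu : p \is a GRing.unit.
  apply: (@unit_congr _ _ 1); rewrite ?unitr1 //.
  by rewrite /p addrAC subrr sub0r unitrN nonunitMl // skew_nonunit.
(* The new first vector is the old one plus [t] times the second; [quad] says that it is
   isotropic. *)
have c2 : congr_mx (mx2 a 1 (-1) d1) (mx2 0 p (- p) d1).
  apply: (@congr_mx2 1 0 t 1); first by rewrite mulr1 mul0r subr0 unitr1.
  rewrite rmorph1 rmorph0 st !mul_mx2 /p; congr mx2; try ring.
  by rewrite -quad; ring.
clearbody p.
set d2 := p^-1 * d1 * p^-1.
have sd2 : star d2 = - d2.
  by rewrite /d2 !rmorphM rmorphV // sp sd1; ring.
have c3 : congr_mx (mx2 0 p (- p) d1) (mx2 0 1 (-1) d2).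
  apply: (@congr_mx2 1 0 0 p^-1); first by rewrite mul1r mul0r subr0 unitrV.
  rewrite rmorph1 rmorph0 rmorphV // sp !mul_mx2 /d2; congr mx2.
  - ring.
  - by rewrite !(mul0r, mulr0, addr0, add0r, mul1r) divrr.
  - by rewrite !(mul0r, mulr0, addr0, add0r, mulr1) mulrN mulVr.
  - ring.
have [h h2] : exists h : A, 2%:R * h = 1 by exists 2%:R^-1; rewrite divrr.
have sh : star h = h.
  apply: (mulrI two_unit); rewrite -{1}(rmorph_nat star 2) -rmorphM h2.
  by rewrite rmorph1.
(* Adding [d2 / 2] times the isotropic vector to the second vector cancels [d2], because [d2] is
   skew and [h] is fixed. *)
have c4 : congr_mx (mx2 0 1 (-1) d2) (mx2 0 1 (-1) 0).
  apply: (@congr_mx2 1 (d2 * h) 0 1).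
    by rewrite mulr1 mulr0 subr0 unitr1.
  rewrite rmorph1 rmorph0 rmorphM sd2 sh !mul_mx2; congr mx2; try ring.
  rewrite [RHS](_ : _ = d2 * (1 - 2%:R * h)); last by ring.
  by rewrite h2 subrr mulr0.
exact: congr_trans c1 (congr_trans c2 (congr_trans c3 c4)).
Qed.

Lemma skew_unit_corner n (N : 'M_(2 + n)) k l : adj N = - N ->
  N k l \is a GRing.unit ->
  exists2 N', congr_mx N N' & ulsubmx N' = Jmx A.
Proof.
move=> HN kl.
have nkl : k != l.
  apply: contraTneq kl => <-; apply: skew_nonunit.
  by have /matrixP/(_ k k) := HN; rewrite !mxE.
pose i0 : 'I_(2 + n) := lshift n 0; pose i1 : 'I_(2 + n) := lshift n 1.
have [s s0 s1] : exists2 s : {perm 'I_(2 + n)}, s i0 = k & s i1 = l.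
  (* The transposition bringing [k] to the first place may move [l], so the second place has to be
     exchanged with the image of [l]. *)
  have tl : tperm i0 k l != i0.
    apply: contraNneq nkl => E.
    by rewrite eq_sym -(inj_eq (@perm_inj _ (tperm i0 k))) E tpermR.
  exists (tperm i1 (tperm i0 k l) * tperm i0 k)%g; rewrite permM.
    by rewrite (tpermD _ tl) ?tpermL.
  by rewrite tpermL tpermK.
have := congr_reindex star N s; set N2 := \matrix_(i, j) _ => c2.
have [|N3 c3 E3] := @congr_ulsub _ star _ _ N2 (Jmx A); last first.
  by exists N3 => //; apply: congr_trans c3.
apply: skew_mx2; last by rewrite !mxE -/i0 -/i1 s0 s1.
apply/matrixP=> i j; rewrite !mxE.
by have /matrixP/(_ (s (lshift n i)) (s (lshift n j))) := HN; rewrite !mxE.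
Qed.

Variables be bd : bool.
Hypothesis y_star : star y = (-1) ^+ bd * y.

(** Booleans code signs: [be] that of the form, [bd] that of [y]. Dividing by [y ^+ i] leaves a form
    of sign [(-1) ^+ alt i], alternating in type when [alt i] holds. *)
Let alt i := be (+) (bd && odd i).

Lemma star_uniformiserX i : star (y ^+ i) = (-1) ^+ (bd && odd i) * y ^+ i.
Proof.
rewrite rmorphXn y_star exprMn -exprM; congr (_ * _).
by case: bd; rewrite ?mul1n ?mul0n //= signr_odd.
Qed.

Lemma adj_unscale m i (N : 'M[A]_m) :
  adj (y ^+ i *: N) = (-1) ^+ be *: (y ^+ i *: N) ->
  adj N = (-1) ^+ alt i *: N.
Proof.
move=> H; apply/matrixP=> k l; have /matrixP/(_ k l) := H.
rewrite !mxE rmorphM star_uniformiserX => E.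
apply: (mulfI (expf_neq0 i (uniformiser_neq0 y_unif))).
rewrite -[LHS](signrMK (bd && odd i)) [X in _ * X = _]mulrA E /alt signr_addb.
ring.
Qed.

(** Strong induction on the size. The factor [y ^+ j] carries a lower bound for the exponents; the
    complement of a brick of exponent [i] is treated with [i] in place of [j], which makes the list
    sorted. *)
Lemma brick_mx_exists m j (N : 'M[A]_m) :
  adj (y ^+ j *: N) = (-1) ^+ be *: (y ^+ j *: N) ->
  exists L, [/\ sorted leq L, all (leq j) L, (total_size alt L <= m)%N
    & congr_mx (y ^+ j *: N) (brick_mx y alt L m)].
Proof.
elim/ltn_ind: m j N => m IH j N HM.
have [->|M0] := eqVneq (y ^+ j *: N) 0.
  by exists [::]; split=> //; apply: congr_refl.
have [i [N1 [k [l [E ukl]]]]] := factor_min_power y_unif A_complete M0.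
(* Otherwise the unit entry of [N1] would be a multiple of [y]. *)
have ji : (j <= i)%N.
  rewrite leqNgt; apply/negP => ij; move/matrixP/(_ k l): E; rewrite !mxE.
  rewrite -(subnKC ij) exprD -mulrA exprSr -mulrA.
  move/(mulfI (expf_neq0 i (uniformiser_neq0 y_unif))) => E.
  move: ukl; rewrite -E unitrM.
  by rewrite (negbTE (uniformiser_nonunit y_unif)).
move: HM; rewrite {N M0}E => /adj_unscale HN.
have Hc n (E : 'M[A]_n) : adj E = (-1) ^+ alt i *: E ->
    adj (y ^+ i *: E) = (-1) ^+ be *: (y ^+ i *: E).
  move=> HE; rewrite adjZ HE star_uniformiserX !scalerA; congr (_ *: _).
  by rewrite /alt addbC signr_addb mulrAC mulrA -expr2 sqrr_sign mul1r.
have weaken L : all (leq i) L -> all (leq j) L.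
  by apply: sub_all => x; apply: leq_trans.
have [a|a] := boolP (alt i).
  have {}HN : adj N1 = - N1 by rewrite HN a expr1 scaleN1r.
  (* A hyperbolic plane needs size at least 2; in size 1 the only entry is skew, hence not a
     unit. *)
  case: m => [|[|m]] in IH N1 k l ukl HN *; first by case: k ukl => [].
    have /negP[] : N1 0 0 \isn't a GRing.unit; last first.
      by rewrite -{1}(ord1 k) -(ord1 l).
    apply: skew_nonunit.
    by have /matrixP/(_ 0 0) := HN; rewrite !mxE.
  have [N2 c2 E2] := skew_unit_corner (n := m) HN ukl.
  have HN2 : adj N2 = (-1) ^+ true *: N2.
    by apply: congr_adj c2; rewrite ?expr1 ?scaleN1r.
  have [|E c3] := split_unit_block (m := 2) starK HN2.
    by rewrite E2 Jmx2 unit_mx2 mulr0 mul1r opprK add0r unitr1.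
  rewrite E2 in c3; have HE : adj E = (-1) ^+ alt i *: E.
    have := congr_adj starK HN2 c3; rewrite adj_block scale_block_mx a.
    by move/eq_block_mx => [].
  have [L [sL aL tL cL]] := IH m (ltnW (ltnSn _)) i E (Hc _ _ HE).
  exists (i :: L); split; first by rewrite /= path_min_sorted.
  - by rewrite /= ji weaken.
  - by rewrite /total_size /= /brick_size a.
  rewrite /= a; apply: congr_trans (congr_scale _ (congr_trans c2 c3)) _.
  rewrite scale_block_mx !scaler0; apply: congr_block => //.
  exact: congr_refl.
have {}HN : adj N1 = N1 by rewrite HN (negbTE a) scale1r.
case: m => [|m] in IH N1 k l ukl HN *; first by case: k ukl => [].
have [N2 c2 E2] := herm_unit_corner (n := m) HN ukl.
have HN2 : adj N2 = (-1) ^+ false *: N2.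
  by apply: congr_adj c2; rewrite ?scale1r.
have [|E c3] := split_unit_block (m := 1) starK HN2.
  by rewrite E2 unitmx1.
rewrite E2 in c3; have HE : adj E = (-1) ^+ alt i *: E.
  have := congr_adj starK HN2 c3; rewrite adj_block scale_block_mx (negbTE a).
  by move/eq_block_mx => [].
have [L [sL aL tL cL]] := IH m (ltnSn _) i E (Hc _ _ HE).
exists (i :: L); split; first by rewrite /= path_min_sorted.
- by rewrite /= ji weaken.
- by rewrite /total_size /= /brick_size (negbTE a).
rewrite /= (negbTE a); apply: congr_trans (congr_scale _ (congr_trans c2 c3)) _.
rewrite scale_block_mx !scaler0 scalemx1; apply: congr_block => //.
exact: congr_refl.
Qed.

End Reduction.

(** * Normal forms correspond to sorted lists of exponents *)

Section NormalFormBricks.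
Variables (A : dvrType) (y : A) (alt : pred nat).

Local Notation brick_mx := (brick_mx y alt).
Local Notation brick_size := (brick_size alt).
Local Notation total_size := (total_size alt).

(** The dependent match follows that of [brick_size], so both kinds of bricks can be treated
    together. *)
Definition brick i : 'M[A]_(brick_size i) :=
  y ^+ i *:
    (if alt i as b return 'M_(if b then 2 else 1%N) then Jmx A else 1%:M).

Lemma brick_mx_cons i L n :
  brick_mx (i :: L) (brick_size i + n) = block_mx (brick i) 0 0 (brick_mx L n).
Proof. by rewrite /brick /brick_size /=; case: (alt i); rewrite ?scalemx1. Qed.

Lemma brick_size_gt0 i : (0 < brick_size i)%N.
Proof. by rewrite /brick_size; case: ifP. Qed.

Lemma castmx_brick m n (e : m = n) L :
  castmx (e, e) (brick_mx L m) = brick_mx L n.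
Proof. by case: n / e; rewrite castmx_id. Qed.

Lemma total_size_cat L1 L2 :
  total_size (L1 ++ L2) = (total_size L1 + total_size L2)%N.
Proof. by rewrite /total_size map_cat sumn_cat. Qed.

Lemma total_size_nseq c i : total_size (nseq c i) = (c * brick_size i)%N.
Proof. by rewrite /total_size map_nseq sumn_nseq mulnC. Qed.

Lemma block_mx0l (R : nmodType) n (B : 'M[R]_n) :
  block_mx (0 : 'M_0) 0 0 B = B :> 'M_(0 + n).
Proof.
apply/matrixP => i j; rewrite !mxE.
case: splitP => [[]//|i' Ei]; rewrite mxE; case: splitP => [[]//|j' Ej].
by congr (B _ _); apply: val_inj.
Qed.

Lemma block_mx0r (R : nmodType) n (B : 'M[R]_n) :
  block_mx B 0 0 (0 : 'M_0) = castmx (esym (addn0 n), esym (addn0 n)) B.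
Proof.
apply/matrixP => i j; rewrite castmxE !mxE.
case: splitP => [i' Ei|[]//]; rewrite mxE; case: splitP => [j' Ej|[]//].
by congr (B _ _); apply: val_inj.
Qed.

(** [L1] has to fill its block exactly: zero padding would come between it and the bricks of
    [L2]. *)
Lemma brick_mx_cat L1 L2 n1 n2 : total_size L1 = n1 ->
  block_mx (brick_mx L1 n1) 0 0 (brick_mx L2 n2) =
  brick_mx (L1 ++ L2) (n1 + n2).
Proof.
move=> <- {n1}; elim: L1 => [|i L1 IH]; first exact: block_mx0l.
rewrite -[total_size (i :: L1)]/(brick_size i + total_size L1)%N.
rewrite cat_cons -(castmx_brick (addnA _ _ _)) !brick_mx_cons -IH.
have := block_mxAx (brick i) 0 (0 : 'M_(_, n2)) 0 (brick_mx L1 (total_size L1))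
  0 (0 : 'M_(n2, _)) 0 (brick_mx L2 n2).
rewrite !row_mx0 !col_mx0 /= => ->.
by rewrite castmx_comp !(eq_irrelevance (etrans _ _) erefl) castmx_id.
Qed.

Lemma mxdiag_brick K (p : 'I_K -> nat) (L : 'I_K -> seq nat)
    (M : forall i, 'M[A]_(p i)) :
  (forall i, M i = brick_mx (L i) (p i)) ->
  (forall i, total_size (L i) = p i) ->
  (\mxdiag_i M i = brick_mx (flatten [seq L i | i <- enum 'I_K]) (\sum_i p i))
  /\ (total_size (flatten [seq L i | i <- enum 'I_K]) = \sum_i p i)%N.
Proof.
elim: K p L M => [|K IH] p L M HM Hp.
  split; last by rewrite big_ord0 enum_ord0.
  by apply/matrixP => i; have := ltn_ord i; rewrite {2}big_ord0.
have [IHM IHs] := IH _ _ _ (fun i => HM (lift ord0 i))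
  (fun i => Hp (lift ord0 i)).
rewrite enum_ordSl /= -map_comp; split; last first.
  by rewrite total_size_cat Hp IHs big_ord_recl.
by rewrite mxdiag_recl HM IHM brick_mx_cat // castmx_brick.
Qed.

Lemma brick_mx_nseq1 n i : ~~ alt i ->
  y ^+ i *: 1%:M = brick_mx (nseq n i) n.
Proof.
move=> /negbTE a; rewrite scalemx1; elim: n => [|n IH]; first exact: flatmx0.
by rewrite /= a -IH -scalar_mx_block.
Qed.

Lemma brick_mx_nseq2 n i (B : 'M[A]_n) : alt i -> is_dirsum_J B ->
  n = (n %/ 2 * 2)%N /\ y ^+ i *: B = brick_mx (nseq (n %/ 2) i) n.
Proof.
move=> a [c [e ->]] {B}.
have E : (n = c * 2)%N by rewrite -e sum_nat_const card_ord.
have -> : (n %/ 2 = c)%N by rewrite E mulnK.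
split=> {E}//; case: n / e; rewrite castmx_id.
have -> : y ^+ i *: (\mxdiag_(j < c) Jmx A) = \mxdiag_(j < c) (y ^+ i *: Jmx A).
  apply/matrixP => k l; rewrite !mxE; case: ifP => _; rewrite ?mxE ?mulr0 //.
  by rewrite !conform_mx_id !mxE.
have -> : nseq c i = flatten [seq [:: i] | j <- enum 'I_c].
  by rewrite -{1}[c]size_enum_ord; elim: (enum 'I_c) => //= j r <-.
apply: (mxdiag_brick _ _).1 => j; last by rewrite /total_size /= /brick_size a.
rewrite /= a; apply: etrans (esym (block_mx0r (y ^+ i *: Jmx A))).
by rewrite castmx_id.
Qed.

Lemma sorted_blocks (c : nat -> nat) a K :
  sorted leq (flatten [seq nseq (c i) i | i <- iota a K]).
Proof.
(* The lower bound [a] on all exponents is carried along to make the induction work. *)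
suff [] : pairwise leq (flatten [seq nseq (c i) i | i <- iota a K])
    /\ all (leq a) (flatten [seq nseq (c i) i | i <- iota a K]).
  by move=> H _; rewrite sorted_pairwise //; apply: leq_trans.
elim: K a => [|K IH] a //=; have [pw al] := IH a.+1.
have {}al : all (leq a) (flatten [seq nseq (c i) i | i <- iota a.+1 K]).
  by apply: sub_all al => x /ltnW.
rewrite pairwise_cat all_cat pw al all_nseq leqnn orbT; split=> //.
apply/andP; split; last first.
  rewrite andbT; elim: (c a) => //= n ->.
  by rewrite andbT all_nseq leqnn orbT.
by rewrite /allrel all_nseq; apply/orP; right.
Qed.

(** The exponent list of a normal form with block sizes [s], one entry per brick; the final zero
    block leaves no trace in it. *)
Definition blocks (s : nat -> nat) K :=
  flatten [seq nseq (s i %/ brick_size i) i | i <- iota 0 K].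

Lemma normal_form_blocks K s q (M : forall i, 'M[A]_(s i)) :
  (forall i, (0 < s i)%N -> if alt i then is_dirsum_J (M i) else M i = 1%:M) ->
  forall m (e : (\sum_(i < K) s i + q)%N = m),
  castmx (e, e) (block_mx (\mxdiag_(i < K) (y ^+ i *: M i)) 0 0 (0 : 'M_q))
    = brick_mx (blocks s K) m
  /\ (total_size (blocks s K) = \sum_(i < K) s i)%N.
Proof.
move=> HM m e.
have brickM i : (s i = s i %/ brick_size i * brick_size i)%N /\
    y ^+ i *: M i = brick_mx (nseq (s i %/ brick_size i) i) (s i).
  have [s0|spos] := posnP (s i).
    split; first by rewrite s0 div0n.
    by apply/matrixP => k; have := ltn_ord k; rewrite {2}s0.
  have := HM i spos; rewrite /brick_size; case: ifP => a.
    exact: brick_mx_nseq2.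
  by rewrite divn1 muln1 => ->; rewrite brick_mx_nseq1 ?a.
have [E T] := mxdiag_brick (K := K) (fun i => (brickM i).2)
  (fun i => etrans (total_size_nseq _ _) (esym (brickM i).1)).
have bE : flatten [seq nseq (s i %/ brick_size i) (val i) | i : 'I_K <- enum 'I_K]
    = blocks s K by rewrite /blocks -val_enum_ord -map_comp.
rewrite bE in E T; split=> //.
(* The final zero block is the matrix of the empty list. *)
rewrite E; have := brick_mx_cat [::] q T; rewrite /= cats0 => ->.
exact: castmx_brick.
Qed.

(** Both lists are sorted, so it is enough to compare multiplicities; the bound exceeds the largest
    exponent by one so that all are reached. *)
Lemma blocks_count L : sorted leq L ->
  blocks (fun i => count_mem i L * brick_size i)%N (\max_(i <- L) i).+1 = L.
Proof.
move=> sL; apply: (sorted_eq leq_trans anti_leq) => //.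
  exact: sorted_blocks.
rewrite /perm_eq; apply/allP => x _ /=; apply/eqP.
rewrite count_flatten -map_comp sumnE big_map.
under eq_bigr => i _ do rewrite /= count_nseq /= mulnK ?brick_size_gt0 //.
have [xL|xL] := boolP (x \in L).
  rewrite (bigD1_seq x) ?iota_uniq ?mem_iota //=; last first.
    by rewrite add0n ltnS; apply: leq_bigmax_seq.
  by rewrite eqxx mul1n big1 ?addn0 // => i /negbTE->.
rewrite (count_memPn xL) big1 // => i _.
by case: eqP => [->|//]; rewrite (count_memPn xL).
Qed.

Lemma normal_form_sorted m (D : 'M[A]_m) : normal_form y alt D ->
  exists2 L, sorted leq L & (total_size L <= m)%N /\ D = brick_mx L m.
Proof.
move=> [K [s [q [M [e [_ HM ->]]]]]].
have [-> T] := normal_form_blocks HM e.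
exists (blocks s K); first exact: sorted_blocks.
by split=> //; rewrite T -e leq_addr.
Qed.

Lemma sorted_normal_form m L : sorted leq L -> (total_size L <= m)%N ->
  normal_form y alt (brick_mx L m).
Proof.
move=> sL tL; pose c i := count_mem i L.
pose s i := if alt i then (\sum_(j < c i) 2)%N else c i.
pose M i : 'M[A]_(s i) :=
  match alt i as b return 'M_(if b then (\sum_(j < c i) 2)%N else c i) with
  | true => \mxdiag_(j < c i) Jmx A
  | false => 1%:M
  end.
have sE i : s i = (c i * brick_size i)%N.
  by rewrite /s /brick_size; case: (alt i); rewrite ?muln1 //
    sum_nat_const card_ord.
have HM i : (0 < s i)%N -> if alt i then is_dirsum_J (M i) else M i = 1%:M.
  rewrite /M /s; case: (alt i) => // _.
  by exists (c i), erefl; rewrite castmx_id.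
pose K := (\max_(i <- L) i).+1.
have bE : blocks s K = L.
  rewrite -[RHS]blocks_count //; congr flatten; apply: eq_map => i.
  by rewrite sE.
have T : (\sum_(i < K) s i <= m)%N.
  have [_ <-] := normal_form_blocks (K := K) HM (erefl _ : (_ + 0 = _)%N).
  by rewrite bE.
pose q := (m - \sum_(i < K) s i)%N.
have e : (\sum_(i < K) s i + q = m)%N by rewrite subnKC.
exists K, s, q, M, e; split=> // [i Ki|]; last first.
  by rewrite (normal_form_blocks HM e).1 bE.
rewrite sE /c (count_memPn _) //; apply: contraTN Ki => iL.
by rewrite -ltnNge ltnS; apply: leq_bigmax_seq.
Qed.

End NormalFormBricks.
(** Selecting the rows in [B] and the columns in [C] writes the zero block as a product of matrices
    of ranks [#|B|] and [#|C|]; a zero product bounds the sum of the ranks by [m]. *)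
Lemma unit_zero_block (F : fieldType) m (Q : 'M[F]_m) (B C : {pred 'I_m}) :
  Q \in unitmx -> {in B & C, forall l k, Q l k = 0} -> (#|B| + #|C| <= m)%N.
Proof.
move=> Qu Q0.
pose S (D : {pred 'I_m}) : 'M[F]_(#|D|, m) := rowsub enum_val 1%:M.
have rS D : \rank (S D) = #|D|.
  apply/eqP; rewrite -/(row_free _); apply/row_freeP; exists (S D)^T.
  apply/matrixP => i j; rewrite !mxE (bigD1 (enum_val i)) //= !mxE eqxx mul1r.
  rewrite big1 ?addr0 => [|k /negbTE ki].
    by rewrite (inj_eq enum_val_inj) eq_sym.
  by rewrite !mxE eq_sym ki mul0r.
have SQS : S B *m Q *m (S C)^T = 0.
  rewrite mul_rowsub_mx mul1mx; apply/matrixP => i j; rewrite !mxE.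
  rewrite (bigD1 (enum_val j)) //= !mxE eqxx mulr1.
  rewrite big1 ?addr0 => [|k /negbTE kj].
    by apply: Q0; apply: enum_valP.
  by rewrite !mxE eq_sym kj mulr0.
have := mulmx0_rank_max SQS.
by rewrite mxrank_tr mxrankMfree ?row_free_unit // !rS.
Qed.

(** * Uniqueness: the exponents are invariants *)

Section Uniqueness.
Local Open Scope quotient_scope.
Variables (A : dvrType) (y : A) (alt : pred nat).
Hypothesis y_unif : uniformiser y.

Local Notation brick_mx := (brick_mx y alt).
Local Notation brick_size := (brick_size alt).
Local Notation total_size := (total_size alt).

(* [None] stands for the exponent of the zero block. *)
Definition exp_lt (n : nat) (i : option nat) : bool :=
  if i is Some i' then (i' < n)%N else false.

Definition uexp (i : option nat) : A := if i is Some i' then y ^+ i' else 0.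

(** Since [Jmx] is invertible it is absorbed into [W]; a hyperbolic brick then contributes its
    exponent twice, as the weight [brick_size i] records. *)
Lemma brick_mx_diag L m : (total_size L <= m)%N ->
  exists W (f : 'I_m -> option nat),
    [/\ W \in unitmx, brick_mx L m = W *m diag_mx (\row_k uexp (f k))
      & forall n,
        (\sum_k exp_lt n (f k) = \sum_(i <- L | i < n) brick_size i)%N].
Proof.
elim: L m => [|i L IH] m.
  move=> _; exists 1%:M, (fun=> None); split; first exact: unitmx1.
    rewrite mul1mx; apply/matrixP => k l; rewrite !mxE mul0rn //.
  by move=> n; rewrite big_nil big1.
rewrite [total_size _]/(brick_size i + total_size L)%N => tL.
have := leq_trans (leq_addr _ _) tL => bm.
move: tL; rewrite -(subnKC bm) leq_add2l; move: (m - _)%N => m' {bm m}.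
move=> /IH [W [f [Wu E C]]] {IH}.
pose W0 : 'M[A]_(brick_size i) :=
  if alt i as b return 'M_(if b then 2 else 1%N) then Jmx A else 1%:M.
have W0u : W0 \in unitmx.
  rewrite /W0 /brick_size; case: (alt i); last exact: unitmx1.
  by rewrite Jmx2 unit_mx2 mulr0 mul1r opprK add0r unitr1.
exists (block_mx W0 0 0 W),
  (fun k => match split k with inl _ => Some i | inr k' => f k' end); split.
- by rewrite unitmxE det_ublock unitrM -!unitmxE W0u.
- rewrite brick_mx_cons E.
  have -> : (\row_k uexp (match split k with
      inl _ => Some i | inr k' => f k' end)) =
      row_mx (const_mx (y ^+ i) : 'rV_(brick_size i)) (\row_k uexp (f k)).
    by apply/matrixP => a k; rewrite !mxE; case: (split k) => k'; rewrite mxE.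
  rewrite diag_mx_row mulmx_block !(mulmx0, mul0mx, addr0, add0r).
  by rewrite diag_const_mx mul_mx_scalar.
move=> n; rewrite big_split_ord big_cons /= -C.
have -> : (\sum_(k < brick_size i) exp_lt n
    (match split (lshift m' k) with inl _ => Some i | inr k' => f k' end)
    = \sum_(k < brick_size i) (i < n))%N.
  by apply: eq_bigr => k _; case: split_ordP => k' /eqP; rewrite eq_shift.
have -> : (\sum_k exp_lt n
    (match split (rshift (brick_size i) k) with
     inl _ => Some i | inr k' => f k' end) = \sum_k exp_lt n (f k))%N.
  apply: eq_bigr => k _.
  by case: split_ordP => k' /eqP; rewrite eq_shift // => /eqP->.
by rewrite sum_nat_const card_ord; case: ifP => _; rewrite ?muln1 ?muln0.
Qed.

(** Stated for two-sided equivalence, so that exchanging the lists and inverting [P] and [Q] gives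
    the reverse inequality. *)
Lemma brick_count_le m L L' (P Q : 'M[A]_m) n :
  (total_size L <= m)%N -> (total_size L' <= m)%N ->
  P \in unitmx -> Q \in unitmx -> brick_mx L' m = P *m brick_mx L m *m Q ->
  (\sum_(i <- L | i < n) brick_size i <= \sum_(i <- L' | i < n) brick_size i)%N.
Proof.
move=> tL tL' Pu Qu E.
have [W [f [Wu EL <-]]] := brick_mx_diag tL.
have [W' [f' [Wu' EL' <-]]] := brick_mx_diag tL'.
set d := \row_k uexp (f k) in EL; set d' := \row_k uexp (f' k) in EL'.
have PWu : P *m W \in unitmx by rewrite unitmx_mul Pu.
pose R := invmx (P *m W) *m W'.
have H : R *m diag_mx d' = diag_mx d *m Q.
  by rewrite /R -mulmxA -EL' E EL [P *m (W *m _)]mulmxA -mulmxA mulKmx.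
pose Qr := map_mx (\pi_(residue A)) Q.
have Qru : Qr \in unitmx by rewrite unitmxE det_map_mx rmorph_unit.
pose B := [pred k | exp_lt n (f k)]; pose C := [pred k | ~~ exp_lt n (f' k)].
have /(unit_zero_block Qru) : {in B & C, forall l k, Qr l k = 0}.
  move=> l k; rewrite !inE => Hl Hk; rewrite mxE; apply/eqP.
  rewrite residue_pi_eq0; move/matrixP/(_ l k): H.
  rewrite mul_mx_diag mul_diag_mx !mxE.
  (* Both an exponent at least [n] and the zero block give a multiple of [y ^+ n]; cancelling
     [y ^+ i] with [i < n] then leaves a factor [y] in [Q l k]. *)
  have [a ->] : exists a, uexp (f' k) = y ^+ n * a.
    case: (f' k) Hk => [j|] /=; last by exists 0; rewrite mulr0.
    by rewrite -leqNgt => nj; exists (y ^+ (j - n)); rewrite -exprD subnKC.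
  case: (f l) Hl => //= i ltin.
  rewrite -(subnKC ltin) addSn -addnS exprD.
  rewrite mulrCA -!mulrA => /(mulfI (expf_neq0 i (uniformiser_neq0 y_unif))) <-.
  rewrite inE exprS -mulrA [y * _]mulrC nonunitMl //.
  exact: uniformiser_nonunit.
have cardE g : (\sum_k exp_lt n (g k))%N = #|[pred k : 'I_m | exp_lt n (g k)]|.
  rewrite -sum1_card [RHS]big_mkcond; apply: eq_bigr => k _;
  by rewrite inE; case: exp_lt.
have cardCE : (\sum_k exp_lt n (f' k) + #|C|)%N = m.
  by rewrite cardE; apply: etrans (cardC _) (card_ord m).
move/leq_trans/(_ (eq_leq (esym cardCE))); rewrite leq_add2r; apply: leq_trans.
by rewrite cardE.
Qed.

Lemma brick_mx_congr_inj m L L' (P Q : 'M[A]_m) :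
  sorted leq L -> sorted leq L' ->
  (total_size L <= m)%N -> (total_size L' <= m)%N ->
  P \in unitmx -> Q \in unitmx -> brick_mx L' m = P *m brick_mx L m *m Q ->
  L = L'.
Proof.
move=> sL sL' tL tL' Pu Qu E.
have E' : brick_mx L m = invmx P *m brick_mx L' m *m invmx Q.
  by rewrite E -!mulmxA mulKmx // mulmxV // mulmx1.
have sumE n : (\sum_(i <- L | i < n) brick_size i
    = \sum_(i <- L' | i < n) brick_size i)%N.
  apply/eqP; rewrite eqn_leq (brick_count_le n _ _ Pu Qu E) //.
  by rewrite (brick_count_le n _ _ _ _ E') // unitmx_inv.
(* The difference of the counts at [i.+1] and [i] isolates the multiplicity of [i]. *)
have countE K i : (\sum_(j <- K | j < i.+1) brick_size j
    = \sum_(j <- K | j < i) brick_size j + count_mem i K * brick_size i)%N.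
  rewrite -sum1_count big_distrl /= (bigID (fun j => j < i)%N) /=.
  congr (_ + _)%N; first by apply: eq_bigl => j; rewrite ltnS; case: ltngtP.
  rewrite big_mkcond [RHS]big_mkcond; apply: eq_bigr => j _ /=.
  by rewrite ltnS; case: ltngtP => // ->; rewrite mul1n.
apply: (sorted_eq leq_trans anti_leq) => //.
apply/allP => i _ /=; apply/eqP/eqP.
rewrite -(eqn_pmul2r (brick_size_gt0 alt i)).
by have /eqP := sumE i.+1; rewrite !countE sumE eqn_add2l.
Qed.

End Uniqueness.

(** * Existence and uniqueness combined, for all signs at once *)

Lemma unique_normal_form (A : dvrType) (star : {rmorphism A -> A}) (y : A)
    (be bd : bool) m (M : 'M[A]_m) :
  complete_dvr A -> (2%:R : A) \is a GRing.unit -> involutive star ->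
  uniformiser y -> norm_surjective star -> residue_star star =1 id ->
  star y = (-1) ^+ bd * y -> map_mx star M^T = (-1) ^+ be *: M ->
  exists! D, star_congruent star M D
    /\ normal_form y (fun i => be (+) (bd && odd i)) D.
Proof.
move=> A_complete two_unit starK y_unif norm_surj res_triv y_star HM.
have := brick_mx_exists A_complete two_unit starK y_unif norm_surj res_triv
  y_star (j := 0) (N := M) (be := be).
rewrite scale1r => /(_ HM) [L [sL _ tL cL]].
exists (brick_mx y (fun i => be (+) (bd && odd i)) L m); split.
  by split=> //; apply: sorted_normal_form.
move=> D [[X' X'u ED] /normal_form_sorted[L' sL' [tL' EL']]].
have [X Xu E] := cL; suff -> : L = L' by [].
(* Eliminating [M] between the two congruences relates the two normal forms directly. *)
apply: (brick_mx_congr_inj y_unif sL sL' tL tL' (P := map_mx star X'^T *m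
  invmx (map_mx star X^T)) (Q := invmx X *m X')).
- by rewrite unitmx_mul unitmx_inv !adj_unit.
- by rewrite unitmx_mul unitmx_inv Xu.
rewrite -EL' ED E !mulmxA mulmxKV ?adj_unit // mulmxK //.
Qed.

Theorem theorem7 (A : dvrType) (star : {rmorphism A -> A}) (y : A)
    (A_complete : complete_dvr A)
    (two_unit : (2%:R : A) \is a GRing.unit)
    (starK : involutive star)
    (y_unif : uniformiser y)
    (y_star : ~ trivial_involution star -> star y = - y)
    (norm_surj : norm_surjective star)
    (m : nat) (m_gt0 : (0 < m)%N) :
  (~ trivial_involution star ->
   (* Not in the source, where its absence makes part (1) false: if a unit d
      satisfies star d = - d, then the 1 x 1 matrix (d) has no normal form. *)
   residue_star star =1 id ->
   forall M : 'M[A]_m,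
     (skew_hermitian_mx star M ->
        exists! D, star_congruent star M D
                   /\ normal_form y (fun i => ~~ odd i) D) /\
     (hermitian_mx star M ->
        exists! D, star_congruent star M D
                   /\ normal_form y (fun i => odd i) D)) /\
  (trivial_involution star ->
   forall M : 'M[A]_m,
     (M^T = - M ->
        exists! D, star_congruent star M D
                   /\ normal_form y (fun _ => true) D) /\
     (M^T = M ->
        exists! D, star_congruent star M D
                   /\ normal_form y (fun _ => false) D)).
Proof.
split=> [star_nt res_triv M|star_t M].
  have ys : star y = (-1) ^+ true * y by rewrite mulN1r y_star.
  split=> HM.
    (* For [bd] true the type condition [true (+) odd i] computes to [~~ odd i]. *)
    by apply: (unique_normal_form (be := true) _ _ _ _ _ _ ys);
      rewrite ?scaleN1r.
  by apply: (unique_normal_form (be := false) _ _ _ _ _ _ ys); rewrite ?scale1r.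
have ys : star y = (-1) ^+ false * y by rewrite mul1r star_t.
have res_triv : residue_star star =1 id.
  by move=> x; rewrite /residue_star star_t reprK.
have mapT : map_mx star M^T = M^T by apply/matrixP => i j; rewrite !mxE star_t.
split=> HM.
  apply: (unique_normal_form (be := true) _ _ _ _ _ _ ys) => //.
  by rewrite mapT scaleN1r.
apply: (unique_normal_form (be := false) _ _ _ _ _ _ ys) => //.
by rewrite mapT scale1r.
Qed.
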